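(* Let $a_1,a_2,a_3>0$ be real numbers, $\Delta=\sqrt{a_1a_2a_3}$ and $\Omega=\mathrm{diag}(a_1,a_2,a_3)$. Each unit elliptic quaternion represents an elliptical rotation on the ellipsoid $a_1x^2+a_2y^2+a_3z^2=1$. Precisely: if $$q=q_0+q_1\mathbf i+q_2\mathbf j+q_3\mathbf k=\cos\theta+\boldsymbol\varepsilon_0\sin\theta\in\mathbb H_{a_1,a_2,a_3}$$ is a unit elliptic quaternion, where $\boldsymbol\varepsilon_0$ is a unit vector of $\mathbb R^3_{a_1,a_2,a_3}$, then the linear map $R_\theta(\mathbf v)=q\mathbf vq^{-1}$, $\mathbf v\in\mathbb R^3$, gives an elliptical rotation through the elliptical angle $2\theta$ about the axis $\boldsymbol\varepsilon_0$. The elliptical rotation matrix corresponding to $q$ is $$R_\theta^q=\begin{bmatrix} q_0^2+a_1q_1^2-a_2q_2^2-a_3q_3^2 & 2a_2q_1q_2-2\dfrac{q_0q_3\Delta}{a_1} & 2a_3q_1q_3+2\dfrac{q_0q_2\Delta}{a_1}\\ 2a_1q_1q_2+2\dfrac{q_0q_3\Delta}{a_2} & q_0^2-a_1q_1^2+a_2q_2^2-a_3q_3^2 & 2a_3q_2q_3-2\dfrac{q_0q_1\Delta}{a_2}\\ 2a_1q_1q_3-2\dfrac{q_0q_2\Delta}{a_3} & 2a_2q_2q_3+2\dfrac{q_0q_1\Delta}{a_3} & q_0^2-a_1q_1^2-a_2q_2^2+a_3q_3^2 \end{bmatrix}.$$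
   Context: $\mathbb R^3_{a_1,a_2,a_3}$ denotes $\mathbb R^3$ with the elliptical inner product $\mathcal B(\mathbf u,\mathbf w)=a_1u_1w_1+a_2u_2w_2+a_3u_3w_3=\mathbf u^t\Omega\mathbf w$; unit vector means $\mathcal B(\mathbf u,\mathbf u)=1$. The elliptical vector product is $$\mathcal V(\mathbf u\times\mathbf v)=\Delta\left(\tfrac{u_2v_3-u_3v_2}{a_1},\ \tfrac{u_3v_1-u_1v_3}{a_2},\ \tfrac{u_1v_2-u_2v_1}{a_3}\right).$$ The algebra $\mathbb H_{a_1,a_2,a_3}$ of elliptic quaternions is the real associative algebra with basis $\{1,\mathbf i,\mathbf j,\mathbf k\}$ ($1$ being the identity) and $\mathbf i^2=-a_1$, $\mathbf j^2=-a_2$, $\mathbf k^2=-a_3$, $\mathbf{ij}=\frac{\Delta}{a_3}\mathbf k=-\mathbf{ji}$, $\mathbf{jk}=\frac{\Delta}{a_1}\mathbf i=-\mathbf{kj}$, $\mathbf{ki}=\frac{\Delta}{a_2}\mathbf j=-\mathbf{ik}$. A vector $\mathbf v=(v_1,v_2,v_3)\in\mathbb R^3$ is identified with the pure quaternion $v_1\mathbf i+v_2\mathbf j+v_3\mathbf k$. The conjugate of $q=q_0+q_1\mathbf i+q_2\mathbf j+q_3\mathbf k$ is $\overline q=q_0-q_1\mathbf i-q_2\mathbf j-q_3\mathbf k$ and its norm is $N_q=\sqrt{q\overline q}=\sqrt{q_0^2+a_1q_1^2+a_2q_2^2+a_3q_3^2}$; $q$ is unit if $N_q=1$, in which case $q^{-1}=\overline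 q$. A matrix $R\in\mathbb R^{3\times3}$ is an elliptical rotation matrix (on the ellipsoid $a_1x^2+a_2y^2+a_3z^2=1$) if $R^t\Omega R=\Omega$ and $\det R=1$. Such an $R$ is a rotation through the elliptical angle $\phi$ about the unit axis $\mathbf u$ if $R\mathbf u=\mathbf u$ and $R\mathbf v=\cos\phi\,\mathbf v+\sin\phi\,\mathcal V(\mathbf u\times\mathbf v)$ for every $\mathbf v$ with $\mathcal B(\mathbf u,\mathbf v)=0$. The matrix corresponding to $q$ is the matrix of $\mathbf v\mapsto q\mathbf vq^{-1}$ with respect to the basis $\mathbf i,\mathbf j,\mathbf k$ (acting on column vectors). *)

(* Defs.v *)
From HB Require Import structures.
From mathcomp Require Import all_boot all_order all_algebra ring.
From mathcomp Require Import all_classical all_reals all_analysis.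

Set Implicit Arguments.
Unset Strict Implicit.
Unset Printing Implicit Defensive.

Import Order.TTheory GRing.Theory Num.Theory.
Local Open Scope ring_scope.

Definition mx3_of_rows (R : nzRingType) (rows : seq (seq R)) : 'M[R]_3 :=
  \matrix_(i, j) (nth [::] rows i)`_j.

Definition vec3 (R : nzRingType) (x y z : R) : 'cV[R]_3 :=
  \col_i [:: x; y; z]`_i.

(* The matrix, in the standard basis and acting on column vectors, of a map
   that is meant to be linear. *)
Definition mx_of_map (R : nzRingType) (f : 'cV[R]_3 -> 'cV[R]_3) : 'M[R]_3 :=
  \matrix_(i, j) f (delta_mx j 0) i 0.

Section EllipticSpace.
Variables (R : realType) (a1 a2 a3 : R).

Definition ell_Delta : R := Num.sqrt (a1 * a2 * a3).

Definition ell_Omega : 'M[R]_3 := diag_mx (\row_i [:: a1; a2; a3]`_i).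

(* Vectors are indexed from 0: u 0 0, u 1 0, u 2 0 are u_1, u_2, u_3. *)
Definition ell_dot (u w : 'cV[R]_3) : R :=
  a1 * u 0 0 * w 0 0 + a2 * u 1 0 * w 1 0 + a3 * u 2 0 * w 2 0.

Lemma ell_dotE (u w : 'cV[R]_3) : (u^T *m ell_Omega *m w) 0 0 = ell_dot u w.
Proof.
rewrite /ell_Omega mul_mx_diag mxE !big_ord_recl big_ord0 !mxE /= addr0 addrA.
rewrite [in LHS](_ : lift ord0 ord0 = 1 :> 'I_3); last exact: val_inj.
rewrite [in LHS](_ : lift ord0 (lift ord0 ord0) = 2 :> 'I_3); last first.
  exact: val_inj.
by rewrite /ell_dot; congr (_ + _ + _); congr (_ * _); rewrite mulrC.
Qed.

Definition ell_cross (u v : 'cV[R]_3) : 'cV[R]_3 :=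
  ell_Delta *: vec3 ((u 1 0 * v 2 0 - u 2 0 * v 1 0) / a1)
                    ((u 2 0 * v 0 0 - u 0 0 * v 2 0) / a2)
                    ((u 0 0 * v 1 0 - u 1 0 * v 0 0) / a3).

Definition ell_rotation (M : 'M[R]_3) : Prop :=
  M^T *m ell_Omega *m M = ell_Omega /\ \det M = 1.

Definition ell_rotation_about (phi : R) (u : 'cV[R]_3) (M : 'M[R]_3) : Prop :=
  [/\ ell_rotation M, ell_dot u u = 1, M *m u = u &
      forall v : 'cV[R]_3, ell_dot u v = 0 ->
        M *m v = cos phi *: v + sin phi *: ell_cross u v].

End EllipticSpace.

(* EllQuat q_0 q_1 q_2 q_3 is q_0 + q_1 i + q_2 j + q_3 k. The type carries the
   parameters and their positivity, which is what makes the multiplication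
   below associative (Delta^2 = a1 a2 a3). *)
Record ellquat (R : realType) (a1 a2 a3 : R)
    (ha1 : 0 < a1) (ha2 : 0 < a2) (ha3 : 0 < a3) : Type :=
  EllQuat { qc0 : R; qc1 : R; qc2 : R; qc3 : R }.

Section EllipticQuaternions.
Variables (R : realType) (a1 a2 a3 : R).
Hypotheses (ha1 : 0 < a1) (ha2 : 0 < a2) (ha3 : 0 < a3).

Local Notation H := (ellquat ha1 ha2 ha3).
Local Notation mkq := (EllQuat ha1 ha2 ha3).
Local Notation Delta := (ell_Delta a1 a2 a3).

Local Definition tuple_of_quat (q : H) : R * R * R * R :=
  (qc0 q, qc1 q, qc2 q, qc3 q).
Local Definition quat_of_tuple (t : R * R * R * R) : H :=
  let: (x, y, z, w) := t in mkq x y z w.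
Local Lemma tuple_of_quatK : cancel tuple_of_quat quat_of_tuple.
Proof. by case. Qed.

HB.instance Definition _ := Choice.copy H (can_type tuple_of_quatK).

Definition add_quat (p q : H) : H :=
  mkq (qc0 p + qc0 q) (qc1 p + qc1 q) (qc2 p + qc2 q) (qc3 p + qc3 q).

Definition opp_quat (q : H) : H := mkq (- qc0 q) (- qc1 q) (- qc2 q) (- qc3 q).

Definition scale_quat (c : R) (q : H) : H :=
  mkq (c * qc0 q) (c * qc1 q) (c * qc2 q) (c * qc3 q).

(* The bilinear extension of the multiplication table of 1, i, j, k; see
   ellquat_table. *)
Definition mul_quat (p q : H) : H :=
  mkq
    (qc0 p * qc0 q - a1 * (qc1 p * qc1 q) - a2 * (qc2 p * qc2 q)
       - a3 * (qc3 p * qc3 q))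
    (qc0 p * qc1 q + qc1 p * qc0 q
       + Delta / a1 * (qc2 p * qc3 q - qc3 p * qc2 q))
    (qc0 p * qc2 q + qc2 p * qc0 q
       + Delta / a2 * (qc3 p * qc1 q - qc1 p * qc3 q))
    (qc0 p * qc3 q + qc3 p * qc0 q
       + Delta / a3 * (qc1 p * qc2 q - qc2 p * qc1 q)).

Definition qi : H := mkq 0 1 0 0.
Definition qj : H := mkq 0 0 1 0.
Definition qk : H := mkq 0 0 0 1.

Definition conj_quat (q : H) : H := mkq (qc0 q) (- qc1 q) (- qc2 q) (- qc3 q).

Definition sqnorm_quat (q : H) : R :=
  qc0 q ^+ 2 + a1 * qc1 q ^+ 2 + a2 * qc2 q ^+ 2 + a3 * qc3 q ^+ 2.

Definition norm_quat (q : H) : R := Num.sqrt (sqnorm_quat q).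

Lemma quatP (p q : H) :
  qc0 p = qc0 q -> qc1 p = qc1 q -> qc2 p = qc2 q -> qc3 p = qc3 q -> p = q.
Proof. by case: p q => [????] [????] /= -> -> -> ->. Qed.

Local Lemma addqA : associative add_quat.
Proof. by move=> p q r; apply: quatP; apply: addrA. Qed.
Local Lemma addqC : commutative add_quat.
Proof. by move=> p q; apply: quatP; apply: addrC. Qed.
Local Lemma add0q : left_id (mkq 0 0 0 0) add_quat.
Proof. by move=> p; apply: quatP; apply: add0r. Qed.
Local Lemma addNq : left_inverse (mkq 0 0 0 0) opp_quat add_quat.
Proof. by move=> p; apply: quatP; apply: addNr. Qed.

HB.instance Definition _ := GRing.isZmodule.Build H addqA addqC add0q addNq.

Local Lemma scaleqA (c d : R) (q : H) :
  scale_quat c (scale_quat d q) = scale_quat (c * d) q.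
Proof. by apply: quatP; apply: mulrA. Qed.
Local Lemma scale1q : left_id 1 scale_quat.
Proof. by move=> q; apply: quatP; apply: mul1r. Qed.
Local Lemma scaleqDr : right_distributive scale_quat +%R.
Proof. by move=> c p q; apply: quatP; apply: mulrDr. Qed.
Local Lemma scaleqDl (q : H) : {morph scale_quat^~ q : c d / c + d}.
Proof. by move=> c d; apply: quatP; apply: mulrDl. Qed.

HB.instance Definition _ := GRing.Zmodule_isLmodule.Build R H
  scaleqA scale1q scaleqDr scaleqDl.

Lemma ell_Delta_sqr : Delta ^+ 2 = a1 * a2 * a3.
Proof. by rewrite sqr_sqrtr// !mulr_ge0// ltW. Qed.

Local Lemma a1_neq0 : a1 != 0. Proof. exact: lt0r_neq0. Qed.
Local Lemma a2_neq0 : a2 != 0. Proof. exact: lt0r_neq0. Qed.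
Local Lemma a3_neq0 : a3 != 0. Proof. exact: lt0r_neq0. Qed.

Local Lemma mulqA : associative mul_quat.
Proof.
move=> p q r.
have h1 := a1_neq0; have h2 := a2_neq0; have h3 := a3_neq0.
have hD := ell_Delta_sqr.
by apply: quatP => /=; field: hD; rewrite ?h1 ?h2 ?h3.
Qed.

Local Lemma mul1q : left_id (mkq 1 0 0 0) mul_quat.
Proof. by move=> p; apply: quatP => /=; ring. Qed.
Local Lemma mulq1 : right_id (mkq 1 0 0 0) mul_quat.
Proof. by move=> p; apply: quatP => /=; ring. Qed.
Local Lemma mulqDl : left_distributive mul_quat +%R.
Proof. by move=> p q r; apply: quatP => /=; ring. Qed.
Local Lemma mulqDr : right_distributive mul_quat +%R.
Proof. by move=> p q r; apply: quatP => /=; ring. Qed.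
Local Lemma oneq_neq0 : mkq 1 0 0 0 != 0.
Proof. by apply/eqP => -[] /eqP; rewrite oner_eq0. Qed.

HB.instance Definition _ := GRing.Zmodule_isNzRing.Build H
  mulqA mul1q mulq1 mulqDl mulqDr oneq_neq0.

Local Lemma scaleqAl (c : R) (p q : H) : c *: (p * q) = (c *: p) * q.
Proof. by apply: quatP => /=; ring. Qed.

HB.instance Definition _ := GRing.Lmodule_isLalgebra.Build R H scaleqAl.

Local Lemma scaleqAr (c : R) (p q : H) : c *: (p * q) = p * (c *: q).
Proof. by apply: quatP => /=; ring. Qed.

HB.instance Definition _ := GRing.Lalgebra_isAlgebra.Build R H scaleqAr.

Lemma ellquat_table :
  [/\ qi * qi = (- a1)%:A, qj * qj = (- a2)%:A & qk * qk = (- a3)%:A] /\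
  [/\ qi * qj = (Delta / a3) *: qk, qj * qk = (Delta / a1) *: qi,
      qk * qi = (Delta / a2) *: qj &
  [/\ qj * qi = - (qi * qj), qk * qj = - (qj * qk) & qi * qk = - (qk * qi)]].
Proof. by do !split; apply: quatP => /=; ring. Qed.

Lemma quatE (q : H) :
  q = (qc0 q)%:A + qc1 q *: qi + qc2 q *: qj + qc3 q *: qk.
Proof. by apply: quatP => /=; ring. Qed.

Lemma mulq_conj (q : H) : q * conj_quat q = (sqnorm_quat q)%:A.
Proof. by rewrite /sqnorm_quat; apply: quatP => /=; ring. Qed.

Lemma conjq_mul (q : H) : conj_quat q * q = (sqnorm_quat q)%:A.
Proof. by rewrite /sqnorm_quat; apply: quatP => /=; ring. Qed.

Local Lemma sqnormq_neq0 (q : H) : q != 0 -> sqnorm_quat q != 0.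
Proof.
apply: contra_neq => /eqP.
have s0 (a x : R) : 0 < a -> 0 <= a * x ^+ 2.
  by move=> /ltW a0; rewrite mulr_ge0 ?sqr_ge0.
have s1 := s0 _ (qc1 q) ha1; have s2 := s0 _ (qc2 q) ha2.
have s3 := s0 _ (qc3 q) ha3.
rewrite /sqnorm_quat !paddr_eq0 ?(addr_ge0, sqr_ge0)//.
rewrite !mulf_eq0 !orbb.
rewrite (negbTE a1_neq0) (negbTE a2_neq0) (negbTE a3_neq0) /=.
by move=> /andP[/andP[/andP[/eqP ? /eqP ?] /eqP ?] /eqP ?]; apply: quatP.
Qed.

Definition inv_quat (q : H) : H := (sqnorm_quat q)^-1 *: conj_quat q.

Local Lemma mulVq : {in [pred q : H | q != 0], left_inverse 1 inv_quat *%R}.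
Proof.
move=> q q0; rewrite /inv_quat -scalerAl conjq_mul scalerA.
by rewrite mulVf ?scale1r// sqnormq_neq0.
Qed.

Local Lemma mulqV : {in [pred q : H | q != 0], right_inverse 1 inv_quat *%R}.
Proof.
move=> q q0; rewrite /inv_quat -scalerAr mulq_conj scalerA.
by rewrite mulVf ?scale1r// sqnormq_neq0.
Qed.

Local Lemma unitqP (p q : H) :
  q * p = 1 /\ p * q = 1 -> [pred q : H | q != 0] p.
Proof.
move=> [+ _]; apply: contra_eqN => /eqP->.
by rewrite mulr0 eq_sym oner_neq0.
Qed.

Local Lemma invq_out : {in [predC [pred q : H | q != 0]], inv_quat =1 id}.
Proof.
by move=> q; rewrite inE /= negbK => /eqP ->; apply: quatP => /=; ring.
Qed.

HB.instance Definition _ :=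
  GRing.NzRing_hasMulInverse.Build H mulVq mulqV unitqP invq_out.

Lemma invq_unit_norm (q : H) : norm_quat q = 1 -> q^-1 = conj_quat q.
Proof.
move=> nq; have sq : sqnorm_quat q = 1.
  have /ltW s0 : 0 < sqnorm_quat q by rewrite -sqrtr_gt0 -/(norm_quat q) nq ltr01.
  by rewrite -(sqr_sqrtr s0) -/(norm_quat q) nq expr1n.
by rewrite /GRing.inv/= /inv_quat sq invr1 scale1r.
Qed.

Definition pure_quat (v : 'cV[R]_3) : H := v 0 0 *: qi + v 1 0 *: qj + v 2 0 *: qk.

Definition vec_quat (q : H) : 'cV[R]_3 := vec3 (qc1 q) (qc2 q) (qc3 q).

(* v |-> q v q^-1 on R^3. Taking the vector part loses nothing as soon as
   q v q^-1 is pure. *)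
Definition rot_quat (q : H) (v : 'cV[R]_3) : 'cV[R]_3 := vec_quat (q * pure_quat v * q^-1).

End EllipticQuaternions.

Arguments qi {R a1 a2 a3 ha1 ha2 ha3}.
Arguments qj {R a1 a2 a3 ha1 ha2 ha3}.
Arguments qk {R a1 a2 a3 ha1 ha2 ha3}.
Arguments pure_quat {R a1 a2 a3 ha1 ha2 ha3} v.

(* Main.v *)
(* Conjugation by a unit quaternion q is v |-> q v q^*, whose matrix M satisfies
   M^t Omega M = N_q^4 Omega and det M = N_q^6.  If q = c + s u with u a unit
   pure quaternion, then u^2 = -1, so q commutes with u and fixes it; a pure v
   orthogonal to u anticommutes with u, so q v q^* = q^2 v, where
   q^2 = cos (2 theta) + sin (2 theta) u and u v is the elliptical vector
   product. *)
Require Import Defs.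
From HB Require Import structures.
From mathcomp Require Import all_boot all_order all_algebra ring.
From mathcomp Require Import all_classical all_reals all_analysis.

Import Order.TTheory GRing.Theory Num.Theory.
Local Open Scope ring_scope.

Section Matrix3.
Variable R : comNzRingType.

Lemma sum_ord3 (V : nmodType) (F : 'I_3 -> V) : \sum_i F i = F 0 + F 1 + F 2.
Proof.
rewrite !big_ord_recl big_ord0 addr0 addrA.
by congr (_ + F _ + F _); apply: val_inj.
Qed.

Lemma forall_ord3 (P : 'I_3 -> Prop) : P 0 -> P 1 -> P 2 -> forall i, P i.
Proof.
move=> P0 P1 P2 [[|[|[|//]]] i3].
- by rewrite (_ : Ordinal i3 = 0) //; apply: val_inj.
- by rewrite (_ : Ordinal i3 = 1) //; apply: val_inj.
- by rewrite (_ : Ordinal i3 = 2) //; apply: val_inj.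
Qed.

Lemma col3P (u v : 'cV[R]_3) :
  u 0 0 = v 0 0 -> u 1 0 = v 1 0 -> u 2 0 = v 2 0 -> u = v.
Proof.
by move=> *; apply/matrixP => i j; rewrite ord1; move: i; apply: forall_ord3.
Qed.

(** A product of equations, not a conjunction, so that it serves as a rewrite multirule. *)
Lemma vec3E (x y z : R) :
  (vec3 x y z 0 0 = x) * (vec3 x y z 1 0 = y) * (vec3 x y z 2 0 = z).
Proof. by rewrite !mxE. Qed.

Lemma det_mx33 (A : 'M[R]_3) :
  \det A = A 0 0 * (A 1 1 * A 2 2 - A 1 2 * A 2 1)
         - A 0 1 * (A 1 0 * A 2 2 - A 1 2 * A 2 0)
         + A 0 2 * (A 1 0 * A 2 1 - A 1 1 * A 2 0).
Proof.
(* Indexing by natural numbers lets the nested [lift]s of the cofactor expansion compute to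
   literals. *)
pose B (i j : nat) := A (inord i) (inord j).
have AE i j : A i j = B i j by rewrite /B !inord_val.
rewrite (expand_det_row _ 0) sum_ord3 /cofactor !(expand_det_row _ ord0).
by rewrite !big_ord_recl !big_ord0 /cofactor !det_mx11 !mxE !AE /=; ring.
Qed.

Lemma mx_of_map_mulmx (A : 'M[R]_3) : mx_of_map (mulmx A) = A.
Proof. by apply/matrixP => i j; rewrite mxE -colE mxE. Qed.

End Matrix3.

Section Rotation.
Variables (R : realType) (a1 a2 a3 : R).
Hypotheses (ha1 : 0 < a1) (ha2 : 0 < a2) (ha3 : 0 < a3).

Local Notation H := (ellquat ha1 ha2 ha3).
Local Notation Delta := (ell_Delta a1 a2 a3).
Local Notation pure := (@pure_quat R a1 a2 a3 ha1 ha2 ha3).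

(** The matrix of [v |-> q v q^*] for arbitrary [q]: with the conjugate in place of the inverse, its
    entries are quadratic forms in the coordinates of [q]. *)
Definition quat_mx (q : H) : 'M[R]_3 :=
  let: EllQuat q0 q1 q2 q3 := q in
  mx3_of_rows
    [:: [:: q0 ^+ 2 + a1 * q1 ^+ 2 - a2 * q2 ^+ 2 - a3 * q3 ^+ 2;
            2 * a2 * q1 * q2 - 2 * (q0 * q3 * Delta / a1);
            2 * a3 * q1 * q3 + 2 * (q0 * q2 * Delta / a1)];
        [:: 2 * a1 * q1 * q2 + 2 * (q0 * q3 * Delta / a2);
            q0 ^+ 2 - a1 * q1 ^+ 2 + a2 * q2 ^+ 2 - a3 * q3 ^+ 2;
            2 * a3 * q2 * q3 - 2 * (q0 * q1 * Delta / a2)];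
        [:: 2 * a1 * q1 * q3 - 2 * (q0 * q2 * Delta / a3);
            2 * a2 * q2 * q3 + 2 * (q0 * q1 * Delta / a3);
            q0 ^+ 2 - a1 * q1 ^+ 2 - a2 * q2 ^+ 2 + a3 * q3 ^+ 2]].

Let ha : [&& a1 != 0, a2 != 0 & a3 != 0].
Proof. by rewrite !gt_eqF. Qed.

Let hD : Delta ^+ 2 = a1 * a2 * a3.
Proof. exact: ell_Delta_sqr. Qed.

Lemma sqnorm_quat_eq1 (q : H) : norm_quat q = 1 -> sqnorm_quat q = 1.
Proof.
(* [Num.sqrt] vanishes on negative reals, so the value 1 itself forces a positive argument. *)
move=> nq; have s0 : 0 < sqnorm_quat q by rewrite -sqrtr_gt0 [Num.sqrt _]nq.
by rewrite -(sqr_sqrtr (ltW s0)) [Num.sqrt _]nq expr1n.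
Qed.

Lemma pure_quatE (v : 'cV[R]_3) :
  pure v = EllQuat ha1 ha2 ha3 0 (v 0 0) (v 1 0) (v 2 0).
Proof. by apply: quatP => /=; ring. Qed.

Lemma pure_quatK : cancel pure (@vec_quat R a1 a2 a3 ha1 ha2 ha3).
Proof. by move=> v; rewrite pure_quatE; apply: col3P; rewrite vec3E. Qed.

Lemma pure_quatD (u v : 'cV[R]_3) : pure (u + v) = pure u + pure v.
Proof. by rewrite !pure_quatE; apply: quatP => /=; rewrite ?mxE ?addr0. Qed.

Lemma pure_quatZ (c : R) (v : 'cV[R]_3) : pure (c *: v) = c *: pure v.
Proof. by rewrite !pure_quatE; apply: quatP => /=; rewrite ?mxE ?mulr0. Qed.

(** The bridge from algebra to geometry: the scalar part disappears for orthogonal vectors, the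
    vector part for parallel ones. *)
Lemma pure_quatM (u v : 'cV[R]_3) :
  pure u * pure v = (- ell_dot a1 a2 a3 u v)%:A + pure (ell_cross a1 a2 a3 u v).
Proof.
rewrite !pure_quatE /ell_dot.
by apply: quatP => /=; rewrite ?mxE /=; ring.
Qed.

(** A coordinatewise check modulo [Delta ^+ 2 = a1 * a2 * a3]; the scalar coordinate cancels, so
    conjugation keeps vectors pure. *)
Lemma quat_conj_pure (q : H) (v : 'cV[R]_3) :
  q * pure v * conj_quat q = pure (quat_mx q *m v).
Proof.
have /and3P[h1 h2 h3] := ha; have := hD.
case: q => q0 q1 q2 q3 D2; rewrite !pure_quatE.
by apply: quatP; rewrite /= ?mxE ?sum_ord3 ?mxE /=; field: D2;
  rewrite ?h1 ?h2 ?h3.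
Qed.

(** An equality of functions, so that one rewrite serves both linearity and [mx_of_map]. *)
Lemma rot_quatE (q : H) : norm_quat q = 1 -> rot_quat q = mulmx (quat_mx q).
Proof.
move=> nq; apply/funext => v.
by rewrite /rot_quat invq_unit_norm// quat_conj_pure pure_quatK.
Qed.

(** The underlying reason is that the norm is multiplicative and [q^*] has the same norm as [q]. *)
Lemma quat_mx_isometry (q : H) :
  (quat_mx q)^T *m ell_Omega a1 a2 a3 *m quat_mx q =
  sqnorm_quat q ^+ 2 *: ell_Omega a1 a2 a3.
Proof.
have /and3P[h1 h2 h3] := ha; have := hD.
case: q => q0 q1 q2 q3 D2; rewrite /sqnorm_quat /ell_Omega mul_mx_diag.
apply/matrixP; apply: forall_ord3; apply: forall_ord3;
  rewrite /= ?mxE ?sum_ord3 ?mxE /= ?mulr1n ?mulr0n;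
  by field: D2; rewrite ?h1 ?h2 ?h3.
Qed.

(** Determinants in [quat_mx_isometry] would give this only up to sign, hence the explicit
    expansion. *)
Lemma det_quat_mx (q : H) : \det (quat_mx q) = sqnorm_quat q ^+ 3.
Proof.
have /and3P[h1 h2 h3] := ha; have := hD.
case: q => q0 q1 q2 q3 D2; rewrite det_mx33 /sqnorm_quat !mxE /=.
by field: D2; rewrite ?h1 ?h2 ?h3.
Qed.

Lemma quat_mx_rotation (q : H) :
  norm_quat q = 1 -> ell_rotation a1 a2 a3 (quat_mx q).
Proof.
move=> /sqnorm_quat_eq1 sq; split.
  by rewrite quat_mx_isometry sq expr1n scale1r.
by rewrite det_quat_mx sq expr1n.
Qed.

Lemma ell_dotC (u v : 'cV[R]_3) :
  ell_dot a1 a2 a3 u v = ell_dot a1 a2 a3 v u.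
Proof. by rewrite /ell_dot; ring. Qed.

Lemma ell_crossC (u v : 'cV[R]_3) :
  ell_cross a1 a2 a3 v u = - ell_cross a1 a2 a3 u v.
Proof. by apply: col3P; rewrite !mxE /=; ring. Qed.

Lemma ell_crossvv (u : 'cV[R]_3) : ell_cross a1 a2 a3 u u = 0.
Proof. by apply: col3P; rewrite !mxE /=; ring. Qed.

Section PolarForm.
Variables (theta : R) (u : 'cV[R]_3).
Hypothesis u1 : ell_dot a1 a2 a3 u u = 1.

Let q : H := (cos theta)%:A + sin theta *: pure u.
Hypothesis nq : norm_quat q = 1.

Lemma sqr_pure_unit : pure u * pure u = -1.
Proof.
(* Writing the zero vector as [0 *: 0] makes [pure_quatZ] yield [pure 0 = 0]. *)
rewrite pure_quatM u1 ell_crossvv -(scale0r 0) pure_quatZ scale0r addr0.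
exact: scaleN1r.
Qed.

Lemma polar_comm_pure : q * pure u = pure u * q.
Proof.
(* Abstracting [pure u] keeps distributivity from opening it into its sum over [qi], [qj], [qk]. *)
rewrite /q; move: (pure u) => w.
by rewrite mulrDl mulrDr -!scalerAl -!scalerAr mul1r mulr1.
Qed.

Lemma conj_polar : conj_quat q = (cos theta)%:A - sin theta *: pure u.
Proof. by rewrite /q !pure_quatE; apply: quatP => /=; ring. Qed.

(** As [u] acts as an imaginary unit, this is the squaring of a complex number of modulus one. *)
Lemma sqr_polar : q * q = (cos (2 * theta))%:A + sin (2 * theta) *: pure u.
Proof.
rewrite mulr_natl mulr2n cosD sinD /q; move: (pure u) sqr_pure_unit => w ww.
rewrite !mulrDl !mulrDr -!scalerAl -!scalerAr ww !mul1r mulr1.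
rewrite !scalerA scalerN scalerBl scalerDl.
rewrite [cos theta * sin theta]mulrC; set x := _ *: _; set y := _ *: _.
by rewrite [y - _]addrC addrACA.
Qed.

Lemma polar_fixes_axis : quat_mx q *m u = u.
Proof.
(* [pure] is injective, so the equation may be checked in the algebra. *)
apply: (can_inj pure_quatK); rewrite -quat_conj_pure polar_comm_pure -mulrA.
by rewrite mulq_conj sqnorm_quat_eq1// scale1r mulr1.
Qed.

Lemma polar_rotates_orthogonal (v : 'cV[R]_3) : ell_dot a1 a2 a3 u v = 0 ->
  quat_mx q *m v =
    cos (2 * theta) *: v + sin (2 * theta) *: ell_cross a1 a2 a3 u v.
Proof.
move=> uv; have uvM : pure u * pure v = pure (ell_cross a1 a2 a3 u v).
  by rewrite pure_quatM uv oppr0 scale0r add0r.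
have vuM : pure v * pure u = - pure (ell_cross a1 a2 a3 u v).
  rewrite pure_quatM ell_dotC uv oppr0 scale0r add0r ell_crossC.
  by rewrite -scaleN1r pure_quatZ scaleN1r.
apply: (can_inj pure_quatK); rewrite -quat_conj_pure -mulrA.
(* Since [u] and [v] anticommute, moving [v] across flips the sign of the [u] term and turns the
   conjugate back into [q]. *)
have -> : pure v * conj_quat q = q * pure v.
  rewrite conj_polar /q; move: (pure u) (pure v) uvM vuM => w x wx xw.
  rewrite mulrBr mulrDl -!scalerAl -!scalerAr mul1r mulr1.
  by rewrite xw wx scalerN opprK.
rewrite mulrA sqr_polar pure_quatD 2!pure_quatZ -uvM.
by move: (pure u) (pure v) => w x; rewrite mulrDl -!scalerAl mul1r.
Qed.

Lemma polar_rotation :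
  ell_rotation_about a1 a2 a3 (2 * theta) u (quat_mx q).
Proof.
split=> //.
- exact: quat_mx_rotation.
- exact: polar_fixes_axis.
- exact: polar_rotates_orthogonal.
Qed.

End PolarForm.
End Rotation.

Theorem theorem7 (R : realType) (a1 a2 a3 : R)
    (ha1 : 0 < a1) (ha2 : 0 < a2) (ha3 : 0 < a3) (q0 q1 q2 q3 : R) :
  let Delta := ell_Delta a1 a2 a3 in
  let q : ellquat ha1 ha2 ha3 := q0%:A + q1 *: qi + q2 *: qj + q3 *: qk in
  norm_quat q = 1 ->
  [/\ linear (rot_quat q),
      forall v : 'cV[R]_3, q * pure_quat v * q^-1 = pure_quat (rot_quat q v),
      ell_rotation a1 a2 a3 (mx_of_map (rot_quat q)),
      forall (theta : R) (eps0 : 'cV[R]_3),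
        ell_dot a1 a2 a3 eps0 eps0 = 1 ->
        q = (cos theta)%:A + sin theta *: pure_quat eps0 ->
        ell_rotation_about a1 a2 a3 (2 * theta) eps0 (mx_of_map (rot_quat q))
    & mx_of_map (rot_quat q) = mx3_of_rows
        [:: [:: q0 ^+ 2 + a1 * q1 ^+ 2 - a2 * q2 ^+ 2 - a3 * q3 ^+ 2;
                2 * a2 * q1 * q2 - 2 * (q0 * q3 * Delta / a1);
                2 * a3 * q1 * q3 + 2 * (q0 * q2 * Delta / a1)];
            [:: 2 * a1 * q1 * q2 + 2 * (q0 * q3 * Delta / a2);
                q0 ^+ 2 - a1 * q1 ^+ 2 + a2 * q2 ^+ 2 - a3 * q3 ^+ 2;
                2 * a3 * q2 * q3 - 2 * (q0 * q1 * Delta / a2)];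
            [:: 2 * a1 * q1 * q3 - 2 * (q0 * q2 * Delta / a3);
                2 * a2 * q2 * q3 + 2 * (q0 * q1 * Delta / a3);
                q0 ^+ 2 - a1 * q1 ^+ 2 - a2 * q2 ^+ 2 + a3 * q3 ^+ 2]]].
Proof.
move=> Delta q nq; rewrite (rot_quatE _ _ _ _ _ _ _ _ nq) mx_of_map_mulmx.
(* [quat_mx] matches on [EllQuat], so it reduces to the displayed matrix once [q] has this form. *)
have qE : q = EllQuat ha1 ha2 ha3 q0 q1 q2 q3 by apply: quatP => /=; ring.
split.
- by move=> c u v; rewrite mulmxDr scalemxAr.
- by move=> v; rewrite invq_unit_norm// quat_conj_pure.
- exact: quat_mx_rotation.
- by move=> theta u u1 qu; rewrite qu; apply: polar_rotation; rewrite // -qu.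
- by rewrite qE.
Qed.
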